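(* For all integers $n\ge0$, $\Delta(n)\in\{0,1,2,3\}$. More specifically, for every integer $m\ge 0$: (i) if $s(m)\equiv0$ and $s(m+1)\equiv1\pmod 3$, then $\Delta(2m)=\Delta(2m+1)=0$; (ii) if $s(m)\equiv0$ and $s(m+1)\equiv2\pmod 3$, then $\Delta(2m)=\Delta(2m+1)=3$; (iii) if $s(m)\equiv1\pmod 3$, then $\Delta(2m)=1$ and $\Delta(2m+1)=2$; (iv) if $s(m)\equiv2\pmod 3$, then $\Delta(2m)=2$ and $\Delta(2m+1)=1$.
   Context: The Stern sequence $(s(n))_{n\ge0}$ is defined by $s(0)=0$, $s(1)=1$, $s(2n)=s(n)$, $s(2n+1)=s(n)+s(n+1)$. For $N\ge0$ and $i\in\{1,2\}$, let $T(N;3,i)=|\{n: 0\le n<N,\ s(n)\equiv i\pmod 3\}|$ (so $T(0;3,i)=0$), and let $\Delta(N)=T(N;3,1)-T(N;3,2)$. *)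

(* Defs.v *)
From mathcomp Require Import all_boot all_order all_algebra.

Set Implicit Arguments.
Unset Strict Implicit.
Unset Printing Implicit Defensive.

Import GRing.Theory.

(* [k] is recursion fuel; any [k >= n] gives the same value on [n]
   (see [stern_fuelE]). *)
Fixpoint stern_fuel (k n : nat) : nat :=
  if k is k'.+1 then
    if n <= 1 then n
    else if odd n then stern_fuel k' n./2 + stern_fuel k' n./2.+1
    else stern_fuel k' n./2
  else 0.

Definition stern (n : nat) : nat := stern_fuel n n.

Lemma stern_fuelE (k n : nat) : n <= k -> stern_fuel k n = stern n.
Proof.
rewrite /stern; have [m] := ubnP n.
elim: m k n => // m IH [|k] [|n] //; rewrite !ltnS => ltnm lenk.
rewrite [LHS]/= [RHS]/=.
case: n ltnm lenk => [|n] // ltnm lenk.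
have h1 : n.+2./2 <= n.+1 by rewrite /= ltnS leq_half_double -addnn leqW ?leq_addr.
have Hs a : a <= n.+1 -> stern_fuel k a = stern_fuel n.+1 a.
  move=> ha; have ltam := leq_ltn_trans ha ltnm.
  by rewrite (IH k a ltam (leq_trans ha lenk)) (IH n.+1 a ltam ha).
case: ifP => [od|_]; last exact: Hs.
congr (_ + _); apply: Hs => //.
rewrite /= !ltnS -[leqRHS]odd_double_half -[odd n]negbK od add1n ltnS.
by rewrite -addnn leq_addr.
Qed.

Lemma stern0 : stern 0 = 0. Proof. by []. Qed.

Lemma stern1 : stern 1 = 1. Proof. by []. Qed.

Lemma stern_double (n : nat) : stern n.*2 = stern n.
Proof.
case: n => // n; rewrite doubleS -(@stern_fuelE n.*2.+1 n.+1); last first.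
  by rewrite ltnS -addnn leq_addr.
by rewrite [stern n.*2.+2]/stern [LHS]/= odd_double /= doubleK.
Qed.

Lemma stern_doubleS (n : nat) : stern n.*2.+1 = stern n + stern n.+1.
Proof.
case: n => // n; rewrite doubleS -(@stern_fuelE n.*2.+2 n.+1); last first.
  by rewrite ltnS -addnn leqW ?leq_addr.
rewrite -(@stern_fuelE n.*2.+2 n.+2); last by rewrite !ltnS -addnn leq_addr.
by rewrite [stern n.*2.+3]/stern [LHS]/= odd_double /= uphalf_double.
Qed.

Definition T (N d i : nat) : nat := #|[set n : 'I_N | stern n == i %[mod d]]|.

Definition Delta (N : nat) : int := ((T N 3 1)%:Z - (T N 3 2)%:Z)%R.

(* Main.v *)
(** Writing [chi] for the nontrivial character mod 3, the values at [2m] and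
    [2m+1] of the Stern sequence add [chi (s m) + chi (s m + s m.+1)] to
    [Delta], and one checks that [Delta (2m)] is a function of the residues of
    [s m] and [s m.+1].  The only step where the residue of [s m.+2] matters is
    [3 %| s m.+1]; it is then the opposite of that of [s m], because [s m.+1]
    always divides [s m + s m.+2]. *)
Require Import Defs.
From mathcomp Require Import all_boot all_order all_algebra.
From mathcomp Require Import zify.

Set Implicit Arguments.
Unset Strict Implicit.
Unset Printing Implicit Defensive.

(** A step of Euclid's algorithm: if (a, b) is the pair at [k], those at [2k] and [2k+1] are (a,
    a+b) and (a+b, b). *)
Lemma stern_coprime (n : nat) : coprime (stern n) (stern n.+1).
Proof.
elim/ltn_ind: n => n; rewrite -(odd_double_half n).
case: (odd n) n./2 => [] k; rewrite ?add1n ?add0n => IH.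
  rewrite -doubleS stern_double stern_doubleS /coprime gcdnC gcdnDr gcdnC.
  by apply: IH; lia.
(* At [k = 0] the index does not drop, so this case is computed. *)
rewrite stern_doubleS stern_double; case: k IH => // k IH.
by rewrite /coprime gcdnDl; apply: IH; lia.
Qed.

(** At an odd middle index the sum equals the middle term; at an even one it is the sum at half the
    index plus twice the middle term. *)
Lemma stern_dvd_neighbours (n : nat) : stern n.+1 %| stern n + stern n.+2.
Proof.
elim/ltn_ind: n => n; rewrite -(odd_double_half n).
case: (odd n) n./2 => [] k; rewrite ?add1n ?add0n => IH.
  rewrite -doubleS stern_double !stern_doubleS.
  have -> : stern k + stern k.+1 + (stern k.+1 + stern k.+2) =
            stern k.+1 * 2 + (stern k + stern k.+2) by lia.
  by rewrite dvdn_addr ?dvdn_mulr //; apply: IH; lia.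
by rewrite -doubleS !stern_double stern_doubleS.
Qed.

Lemma T_recr (N d i : nat) : T N.+1 d i = T N d i + (stern N == i %[mod d]).
Proof.
have TE M : T M d i = \sum_(n < M) (stern n == i %[mod d]).
  by rewrite /T -sum1dep_card big_mkcond; apply: eq_bigr => n _; case: ifP.
by rewrite !TE big_ord_recr.
Qed.

Definition chi (a : nat) : int :=
  ((a == 1 %[mod 3])%:Z - (a == 2 %[mod 3])%:Z)%R.

Lemma Delta_recr (N : nat) : Delta N.+1 = (Delta N + chi (stern N))%R.
Proof. by rewrite /Delta /chi !T_recr; lia. Qed.

(* The value at residues (0, 0) is junk: consecutive terms are coprime. *)
Definition even_value (a b : nat) : int :=
  if a %% 3 == 0 then (if b %% 3 == 2 then 3 else 0)%Z else Posz (a %% 3).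

(** Passage from [2m] to [2m+2], with [a], [b], [c] the terms at [m], [m+1], [m+2]: a finite check
    on residues. *)
Lemma even_value_step (a b c : nat) : coprime a b -> b %| a + c ->
  (even_value a b + chi a + chi (a + b))%R = even_value b c.
Proof.
move=> cop_ab dvd_b.
have nz_ab : ~~ ((3 %| a) && (3 %| b)).
  by rewrite -dvdn_gcd (eqP cop_ab).
have opp_ac : 3 %| b -> 3 %| a + c by move/dvdn_trans; apply.
by rewrite /even_value /chi; do !case: ifP => ?; lia.
Qed.

Lemma Delta_double (m : nat) : Delta m.*2 = even_value (stern m) (stern m.+1).
Proof.
elim: m => [|m IH].
  by rewrite /Delta /T !eq_card0 // => -[].
rewrite doubleS !Delta_recr IH stern_double stern_doubleS.
by apply: even_value_step; [apply: stern_coprime | apply: stern_dvd_neighbours].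
Qed.

Theorem theorem5p6 :
  (forall n : nat, Delta n \in [:: 0%Z; 1%Z; 2%Z; 3%Z]) /\
  (forall m : nat,
    [/\ (stern m = 0 %[mod 3] -> stern m.+1 = 1 %[mod 3] ->
           Delta (2 * m) = 0%Z /\ Delta (2 * m + 1) = 0%Z),
        (stern m = 0 %[mod 3] -> stern m.+1 = 2 %[mod 3] ->
           Delta (2 * m) = 3%Z /\ Delta (2 * m + 1) = 3%Z),
        (stern m = 1 %[mod 3] ->
           Delta (2 * m) = 1%Z /\ Delta (2 * m + 1) = 2%Z) &
        (stern m = 2 %[mod 3] ->
           Delta (2 * m) = 2%Z /\ Delta (2 * m + 1) = 1%Z)]).
Proof.
have D2 m : Delta (2 * m) = even_value (stern m) (stern m.+1).
  by rewrite mul2n Delta_double.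
have D2S m : Delta (2 * m + 1) =
    (even_value (stern m) (stern m.+1) + chi (stern m))%R.
  by rewrite addn1 Delta_recr D2 mul2n stern_double.
split=> [n|m]; last first.
  by rewrite D2 D2S /even_value /chi; split; do !case: ifP => ?; lia.
(* The bound is read off the two closed forms, by the parity of [n]. *)
rewrite !inE; have [m [->|->]] : exists m, n = 2 * m \/ n = 2 * m + 1.
- by exists n./2; lia.
- by rewrite D2 /even_value; do !case: ifP => ?; lia.
- by rewrite D2S /even_value /chi; do !case: ifP => ?; lia.
Qed.
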